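(* Let $P$ be a polygonal knot with $n$ edges embedded in $\mathbb{R}^3$. If $w(K)$ is the writhe of one projection $K$ of $P$, then the number of crossings $c$ of any projection $K'$ of $P$ satisfies $$c \ge \frac{1}{16}\left(|w(K)| - 3n\right).$$
   Context: A polygonal knot with $n$ edges in $\mathbb{R}^3$ is a simple closed curve that is a cyclic union of $n$ straight line segments (edges). Projections are orthogonal projections of $P$ to a plane along a direction in general position, so that the only multiple points are finitely many transverse double points (the crossings); with over/under information they are knot diagrams. Writhe: choose an orientation of $P$. Assign each crossing of the diagram $K$ a sign: $+1$ if the undercrossing is oriented by the right-hand rule relative to the overcrossing, and $-1$ otherwise. The writhe $w(K)$ is the sum of these signs over all crossings; it does not depend on the chosen orientation of $P$, but does depend on the direction of projection. *)

(* Defs.v *)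
From HB Require Import structures.
From mathcomp Require Import all_boot all_order all_algebra finmap.
From mathcomp Require Import all_classical reals.

Set Implicit Arguments.
Unset Strict Implicit.
Unset Printing Implicit Defensive.

Import Order.TTheory GRing.Theory Num.Theory.

Local Open Scope classical_set_scope.
Local Open Scope ring_scope.

Section PolygonalKnots.
Variables (R : realType) (n : nat).

(* A closed polygon is given by its cyclically indexed vertices; edge i runs   *)
(* from P i to P (ordS i), and the cyclic order of the indices orients it.     *)
Implicit Types (P : 'I_n -> 'rV[R]_3) (u v w : 'rV[R]_3) (x y z : 'I_n * R).

Definition edge P (i : 'I_n) : 'rV[R]_3 := P (ordS i) - P i.

(* Each point of the closed polygon corresponds to parameters (i, s) with      *)
(* 0 <= s < 1; the endpoint s = 1 of edge i is the start of edge ordS i.       *)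
Definition params : set ('I_n * R) := [set x | 0 <= x.2 < 1].

Definition point P x : 'rV[R]_3 := P x.1 + x.2 *: edge P x.1.

(* Injectivity on params makes the closed curve simple; in particular it       *)
(* forces the edges to be nondegenerate.                                       *)
Definition polygonal_knot P : Prop :=
  (0 < n)%N /\ set_inj params (point P).

Definition dot v w : R := (v *m w^T) 0 0.

(* Orthogonal projection along u onto the plane orthogonal to u. *)
Definition proj u v : 'rV[R]_3 := v - (dot v u / dot u u) *: u.

Definition double_point u P x y : Prop :=
  [/\ params x, params y, x <> y & proj u (point P x) = proj u (point P y)].

(* Both strands pass through the double point in the interior of an edge, with *)
(* linearly independent projected directions.                                  *)
Definition transverse u P x y : Prop :=
  [/\ 0 < x.2, 0 < y.2 &
      row_free (col_mx (proj u (edge P x.1)) (proj u (edge P y.1)))].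

(* The viewer looks from the direction u: the over strand is the one with the  *)
(* larger coordinate along u. Listing the over parameter first, every double   *)
(* point of a projection in general position occurs exactly once.              *)
Definition crossings u P : set (('I_n * R) * ('I_n * R)) :=
  [set c | double_point u P c.1 c.2 /\
           dot (point P c.2) u < dot (point P c.1) u].

Definition general_position u P : Prop :=
  [/\ u != 0,
      forall x y z, params x -> params y -> params z ->
        proj u (point P x) = proj u (point P y) ->
        proj u (point P y) = proj u (point P z) ->
        [\/ x = y, y = z | x = z],
      forall x y, double_point u P x y -> transverse u P x y
    & finite_set (crossings u P)].

Definition crossing_number_of_projection u P : nat :=
  #|` fset_set (crossings u P)|%fset.

Definition det3 u v w : R := \det (\matrix_(k < 3) tnth [tuple u; v; w] k).

(* Right-hand rule: positive when, seen from the direction u, the over strand  *)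
(* is turned counterclockwise (by less than a half turn) onto the under one.   *)
Definition crossing_sign u P (c : ('I_n * R) * ('I_n * R)) : int :=
  if 0 < det3 (edge P c.1.1) (edge P c.2.1) u then 1 else -1.

Definition writhe u P : int :=
  \sum_(c \in crossings u P) crossing_sign u P c.

End PolygonalKnots.

(* Main.v *)
(* The signed crossings of edges i and j in direction u are the zeros, along
   the ray of u, of the affine map (s, t) |-> P_i(s) - P_j(t) on the unit
   square. In a basis (u, u', w), the points of the square where the
   w-coordinate vanishes form a chord, whose image in the plane of u and u'
   enters or leaves the open quadrant spanned by u and u' exactly when it
   meets the ray of u or that of u'. So the difference between the signed
   crossings in the directions u and u' is a sum of terms, one for each side
   of the square, that depend only on the two corners of the side and change
   sign with its orientation. Summed over all (i, j) these terms cancel. Hence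
   w(K) - w(K') is minus the sum over the at most 3n pairs of equal or
   adjacent edges, each contributing at most 1 in absolute value, and |w(K)|
   <= |w(K')| + 3n <= c + 3n. (If u and u' are parallel, the two projections
   have the same crossings up to exchanging over and under.) *)

Require Import Defs.
From HB Require Import structures.
From mathcomp Require Import all_boot all_order all_algebra finmap.
From mathcomp Require Import all_classical reals.
From mathcomp Require Import ring lra zify.
Import Order.TTheory GRing.Theory Num.Theory.
Local Open Scope ring_scope.

Set Implicit Arguments.
Unset Strict Implicit.

(** * Affine maps on the unit square: boundary flux and local degrees *)

Section Square.
Variable R : realFieldType.
Implicit Types (a b : R * R * R) (p q r : R * R * R) (s t : R).

Definition in_quadrant (x z : R) : bool := (0 < x) && (0 < z).

(** The two quotients are the outer coordinates of the point where the line through [a] and [b]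
    meets the plane y = 0, y being the middle coordinate. *)
Definition quadrant_crossing a b : bool :=
  in_quadrant ((b.1.1 * a.1.2 - a.1.1 * b.1.2) / (a.1.2 - b.1.2))
    ((b.2 * a.1.2 - a.2 * b.1.2) / (a.1.2 - b.1.2)).

(* Counting 0 as positive lets corners of the square lie in the plane y = 0
   without any general position assumption relating u and u'. *)
Definition flux a b : int :=
  if 0 <= a.1.2 then if 0 <= b.1.2 then 0 else (quadrant_crossing a b)%:Z
  else if 0 <= b.1.2 then - (quadrant_crossing a b)%:Z else 0.

Lemma fluxC a b : flux b a = - flux a b.
Proof.
have -> : flux b a = (if 0 <= b.1.2 then if 0 <= a.1.2 then 0
    else (quadrant_crossing a b)%:Z
  else if 0 <= a.1.2 then - (quadrant_crossing a b)%:Z else 0).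
  have -> // : quadrant_crossing a b = quadrant_crossing b a.
  have E k l m n : (k * l - m * n) / (l - n) = (m * n - k * l) / (n - l) :> R.
    by rewrite -opprB -(opprB n l) invrN mulrNN.
  by rewrite /quadrant_crossing !(E b.1.1) (E b.2).
by rewrite /flux; case: ifP; case: ifP; rewrite ?oppr0 ?opprK.
Qed.

Definition affine p s t : R := p.1.1 + s * p.1.2 + t * p.2.

Definition jacobian p q : R := p.1.2 * q.2 - p.2 * q.1.2.

Definition in_square s t : bool := (0 <= s <= 1) && (0 <= t <= 1).

Definition in_open_square s t : bool := (0 < s < 1) && (0 < t < 1).

Definition has_zero p q r : Prop :=
  exists s t, [/\ in_square s t, affine p s t = 0, affine q s t = 0
                & 0 < affine r s t].

(** The sign is opposite to that of the Jacobian in order to match [crossing_sign]: the second edge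
    enters a difference of two points of the knot with a minus sign. *)
Definition local_degree p q r : int :=
  if `[< has_zero p q r >] then if jacobian p q < 0 then 1 else -1 else 0.

Definition transversal p q r : Prop :=
  forall s t, in_square s t -> affine p s t = 0 -> affine q s t = 0 ->
    [/\ in_open_square s t, jacobian p q != 0 & affine r s t != 0].

Definition boundary_flux p q r : int :=
  let c s t := (affine p s t, affine q s t, affine r s t) in
  flux (c 0 0) (c 1 0) + flux (c 1 0) (c 1 1) +
  flux (c 1 1) (c 0 1) + flux (c 0 1) (c 0 0).

(** By [yE] the signs of [q] cannot alternate around the four corners. So at most one side goes from
    nonnegative to negative and at most one goes back, and these two contribute with opposite
    signs. *)
Lemma boundary_flux_le1 p q r : `|boundary_flux p q r| <= 1.
Proof.
have yE : affine q 0 0 + affine q 1 1 = affine q 1 0 + affine q 0 1.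
  by rewrite /affine; ring.
rewrite /boundary_flux /flux /=.
do 4!move: (quadrant_crossing _ _) => ?.
case: (leP 0 (affine q 0 0)) => ?; case: (leP 0 (affine q 1 0)) => ?;
  case: (leP 0 (affine q 1 1)) => ?; case: (leP 0 (affine q 0 1)) => ?;
  by [lia | exfalso; lra].
Qed.

Lemma transversalC p q r : transversal p q r -> transversal q p r.
Proof.
move=> tr s t st q0 p0; have [? D0 ?] := tr s t st p0 q0; split=> //.
by rewrite -oppr_eq0 (_ : - _ = jacobian p q) // /jacobian; ring.
Qed.

Lemma has_zeroC p q r : has_zero p q r <-> has_zero q p r.
Proof. by split=> -[s [t [? ? ? ?]]]; exists s, t. Qed.

(* Up to a factor, the arc length parameter of the zero line of q, directed
   so that q is positive on its left. *)
Definition along q s t : R := q.2 * s - q.1.2 * t.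

Definition chord_start q s t : Prop :=
  [/\ in_square s t, ~~ in_open_square s t, affine q s t = 0
    & forall s' t', in_square s' t' -> affine q s' t' = 0 ->
        along q s t <= along q s' t'].

Definition chord_end q s t : Prop :=
  [/\ in_square s t, ~~ in_open_square s t, affine q s t = 0
    & forall s' t', in_square s' t' -> affine q s' t' = 0 ->
        along q s' t' <= along q s t].

(** Split the displacement along the gradient of [q] and along its rotation by a right angle; the
    first component vanishes on the zero line of [q]. *)
Lemma affine_along p q s t s' t' :
  affine q s t = 0 -> affine q s' t' = 0 ->
  (q.1.2 ^+ 2 + q.2 ^+ 2) * (affine p s' t' - affine p s t) =
  jacobian p q * (along q s' t' - along q s t).
Proof.
move=> q0 q1.
have q01 : affine q s' t' - affine q s t = 0 by rewrite q0 q1 subrr.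
apply/eqP; rewrite -subr_eq0; apply/eqP.
transitivity ((q.1.2 * p.1.2 + q.2 * p.2) * (affine q s' t' - affine q s t)).
  by rewrite /affine /along /jacobian; ring.
by rewrite q01 mulr0.
Qed.

(** * The part of the zero line of [q] inside the square *)

Section Chord.
Variables (p q r : R * R * R) (s1 t1 s2 t2 : R).
Hypotheses (q_neq0 : 0 < q.1.2 ^+ 2 + q.2 ^+ 2) (tr : transversal p q r).
Hypotheses (start1 : chord_start q s1 t1) (end2 : chord_end q s2 t2).
Let a := affine p s1 t1.
Let b := affine p s2 t2.
Let c := affine r s1 t1.
Let d := affine r s2 t2.

Lemma chord_ends_neq0 : a != 0 /\ b != 0.
Proof.
case: start1 end2 => [sq1 nsq1 q1 _] [sq2 nsq2 q2 _].
split; apply/eqP => e0.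
- by case: (tr sq1 e0 q1); rewrite (negPf nsq1).
- by case: (tr sq2 e0 q2); rewrite (negPf nsq2).
Qed.

(** Interpolate between the ends of the chord at the parameter [a / (a - b)], where [p] vanishes;
    convexity keeps the point in the square. *)
Lemma chord_zero : a * b < 0 ->
  exists s t, [/\ in_square s t, affine p s t = 0, affine q s t = 0
    & (a - b) * affine r s t = a * d - b * c].
Proof.
move=> ab0; have ab : a - b != 0 by apply/eqP => ab; nra.
have k01 : 0 <= a / (a - b) <= 1.
  have [ab1|ab1|ab1] := ltgtP 0 (a - b); last by rewrite -ab1 eqxx in ab.
  - by rewrite ler_pdivlMr // ler_pdivrMr // mul0r mul1r; nra.
  - by rewrite ler_ndivlMr // ler_ndivrMr // mul0r mul1r; nra.
have kab : a / (a - b) * (a - b) = a by rewrite divfK.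
move: (a / (a - b)) k01 kab => k k01 kab.
case: start1 end2 => [sq1 _ q1 _] [sq2 _ q2 _].
exists (s1 + k * (s2 - s1)), (t1 + k * (t2 - t1)).
have aff v : affine v (s1 + k * (s2 - s1)) (t1 + k * (t2 - t1)) =
    affine v s1 t1 + k * (affine v s2 t2 - affine v s1 t1).
  by rewrite /affine; ring.
split.
- by move: sq1 sq2; rewrite /in_square => ? ?; nra.
- by rewrite aff -/a -/b -[RHS](subrr a) -[X in _ = _ - X]kab; ring.
- by rewrite aff q1 q2; ring.
- rewrite aff -/c -/d.
  transitivity ((a - b) * c + (k * (a - b)) * (d - c)); first by ring.
  by rewrite kab; ring.
Qed.

Lemma chord_along : along q s1 t1 <= along q s2 t2.
Proof. by case: start1 end2 => _ _ _ le1 [sq2 _ q2 _]; exact: le1. Qed.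

Lemma chord_jacobian :
  (q.1.2 ^+ 2 + q.2 ^+ 2) * (b - a) =
  jacobian p q * (along q s2 t2 - along q s1 t1).
Proof. by case: start1 end2 => _ _ q1 _ [_ _ q2 _]; exact: affine_along. Qed.

(** A zero lies between the two ends in the order of [along], so by [affine_along] the values of [p]
    at the ends have opposite signs, and [r] at the zero is found by interpolation. The converse is
    [chord_zero]. *)
Lemma chord_has_zero :
  has_zero p q r <-> a * b < 0 /\ 0 < (a - b) * (a * d - b * c).
Proof.
have [a0 b0] := chord_ends_neq0.
split=> [[s [t [sq p0 q0 r0]]]|[ab]]; last first.
  have [s [t [sq p0 q0 E]]] := chord_zero ab.
  rewrite -E mulrA -expr2 => abr; exists s, t; split=> //.
  by rewrite ltNge; apply/negP => rle; nra.
case: start1 end2 => [sq1 _ q1 le1] [sq2 _ q2 le2].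
have Ea := affine_along p q0 q1; have Eb := affine_along p q0 q2.
have Ec := affine_along r q0 q1; have Ed := affine_along r q0 q2.
have := le1 _ _ sq q0; have := le2 _ _ sq q0.
rewrite -subr_ge0 -(subr_le0 _ (along q s1 t1)).
rewrite p0 !subr0 -/a -/b in Ea Eb; rewrite -/c -/d in Ec Ed.
move: (along q s2 t2 - along q s t) Eb Ed => m2 Eb Ed m2_ge0.
move: (along q s1 t1 - along q s t) Ea Ec => m1 Ea Ec m1_le0.
move: (jacobian p q) (jacobian r q) Ea Eb Ec Ed => D F Ea Eb Ec Ed.
move: (_ + _) q_neq0 Ea Eb Ec Ed => N N0 Ea Eb Ec Ed.
have ab : a * b < 0.
  rewrite lt_neqAle mulf_neq0 //= -(pmulr_rle0 _ (exprn_gt0 2 N0)).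
  rewrite (_ : N ^+ 2 * (a * b) = (N * a) * (N * b)); last by ring.
  rewrite Ea Eb mulrACA; apply: mulr_ge0_le0; first by rewrite -expr2 sqr_ge0.
  exact: mulr_le0_ge0.
split=> //.
suff -> : a * d - b * c = affine r s t * (a - b).
  rewrite mulrCA pmulr_rgt0 // -expr2 exprn_even_gt0 //=.
  by apply/eqP => E; nra.
apply: (mulfI (lt0r_neq0 (exprn_gt0 2 N0))); apply/eqP; rewrite -subr_eq0.
rewrite (_ : _ - _ = (N * a) * (N * (d - affine r s t)) -
  (N * b) * (N * (c - affine r s t))); last by ring.
by rewrite Ea Eb Ec Ed; apply/eqP; ring.
Qed.

(** Since [along] increases from start to end, [chord_jacobian] gives the Jacobian at a zero the
    sign of [b - a]. *)
Lemma chord_degree :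
  local_degree p q r =
  if (b < 0 < a) && (0 < a * d - b * c) then 1
  else if (a < 0 < b) && (a * d - b * c < 0) then -1 else 0.
Proof.
have := chord_has_zero; rewrite /local_degree; case: asboolP => hz.
  move=> [/(_ hz) [ab W] _]; move: chord_along chord_jacobian.
  rewrite -subr_ge0; move: (_ - along _ _ _) => m m0.
  move: (_ + _) q_neq0 => N N0 E.
  move: (a * d - b * c) W => W W0.
  have [b_lt0|b_gt0|b0] := ltgtP b 0; last by rewrite b0 mulr0 ltxx in ab.
  - have a_gt0 : 0 < a by nra.
    have -> : jacobian p q < 0 by nra.
    by rewrite a_gt0 (_ : 0 < W) //; nra.
  - have a_lt0 : a < 0 by nra.
    have -> : jacobian p q < 0 = false by apply/negbTE; rewrite -leNgt; nra.
    by rewrite a_lt0 (_ : W < 0) //=; nra.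
move=> [_ nz]; case: ifP => [/andP [/andP [? ?] ?]|_].
  by case: hz; apply: nz; split; nra.
case: ifP => [/andP [/andP [? ?] ?]|//].
by case: hz; apply: nz; split; nra.
Qed.

(** A vanishing determinant would make [r] vanish at the common zero of [p] and [q], against
    transversality. *)
Lemma chord_det_neq0 : a * b < 0 -> a * d - b * c != 0.
Proof.
move=> ab; have [s [t [sq p0 q0 <-]]] := chord_zero ab.
have [_ _ r0] := tr sq p0 q0.
by rewrite mulf_neq0 //; apply/eqP => E; nra.
Qed.

End Chord.

(** * The end of the chord on a directed side of the square *)

Section Side.
Variables (p q r : R * R * R) (s0 t0 ds dt : R).
Hypotheses
  (side_square : forall k, 0 <= k <= 1 ->
     in_square (s0 + k * ds) (t0 + k * dt) &&
     ~~ in_open_square (s0 + k * ds) (t0 + k * dt))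
  (square_left : forall s t, in_square s t ->
     0 <= ds * (t - t0) - dt * (s - s0)).
Let corner s t := (affine p s t, affine q s t, affine r s t).
Let ya := affine q s0 t0.
Let yb := affine q (s0 + ds) (t0 + dt).

Lemma side_gradient : ya - yb != 0 -> 0 < q.1.2 ^+ 2 + q.2 ^+ 2.
Proof.
move=> y0; rewrite lt0r addr_ge0 ?sqr_ge0 // andbT.
apply: contraNneq y0 => /eqP.
rewrite paddr_eq0 ?sqr_ge0 // !sqrf_eq0 => /andP [/eqP e1 /eqP e2].
by rewrite /ya /yb /affine e1 e2; apply/eqP; ring.
Qed.

(** On the zero line of [q] this product is the squared gradient times the expression in
    [square_left]. Hence a zero of [q] on the side is extremal for [along]. *)
Lemma side_along s t s' t' : in_square s' t' ->
  affine q s t = 0 -> affine q s' t' = 0 ->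
  ds * (t - t0) - dt * (s - s0) = 0 -> ya - yb != 0 ->
  0 <= (ya - yb) * (along q s' t' - along q s t).
Proof.
move=> sq q0 q1 l0 /side_gradient N0.
have := mulr_ge0 (ltW N0) (square_left sq); congr (0 <= _).
have q01 : affine q s' t' - affine q s t = 0 by rewrite q0 q1 subrr.
apply/eqP; rewrite -subr_eq0; apply/eqP.
transitivity
  ((q.1.2 ^+ 2 + q.2 ^+ 2) * (ds * (t - t0) - dt * (s - s0)) -
   (affine q s' t' - affine q s t) * (q.1.2 * dt - q.2 * ds)).
  by rewrite /ya /yb /affine /along; ring.
by rewrite l0 q01 mul0r mulr0 subrr.
Qed.

(** The zero is at the parameter [ya / (ya - yb)] of the side, and the quotients in
    [quadrant_crossing] are the values of [p] and [r] there. *)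
Lemma side_zero : (0 <= ya) != (0 <= yb) ->
  exists s t, [/\ in_square s t, ~~ in_open_square s t, affine q s t = 0,
    ds * (t - t0) - dt * (s - s0) = 0
    & quadrant_crossing (corner s0 t0) (corner (s0 + ds) (t0 + dt)) =
        in_quadrant (affine p s t) (affine r s t)].
Proof.
move=> sgn; have y0 : ya - yb != 0.
  by apply: contraNneq sgn => /eqP; rewrite subr_eq0 => /eqP ->; rewrite eqxx.
have k01 : 0 <= ya / (ya - yb) <= 1.
  move: sgn; case: (leP 0 ya) => ?; case: (leP 0 yb) => // ? _.
  - by rewrite ler_pdivlMr ?ler_pdivrMr ?mul0r ?mul1r; lra.
  - by rewrite ler_ndivlMr ?ler_ndivrMr ?mul0r ?mul1r; lra.
have /andP [sq nsq] := side_square k01.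
exists (s0 + ya / (ya - yb) * ds), (t0 + ya / (ya - yb) * dt).
have aff v : affine v (s0 + ya / (ya - yb) * ds) (t0 + ya / (ya - yb) * dt) =
    (affine v (s0 + ds) (t0 + dt) * ya - affine v s0 t0 * yb) / (ya - yb).
  apply: (mulIf y0); rewrite divfK // -{1}[affine v _ _]mulr1.
  transitivity ((v.1.1 + s0 * v.1.2 + t0 * v.2) * (ya - yb) +
    (ya / (ya - yb) * (ya - yb)) * (ds * v.1.2 + dt * v.2)).
    by rewrite /affine; ring.
  by rewrite divfK // /affine; ring.
split=> //; last by rewrite /quadrant_crossing !aff.
- by rewrite aff -/ya -/yb (mulrC yb) subrr mul0r.
- by ring.
Qed.

Lemma side_start : 0 <= ya -> yb < 0 ->
  exists s t, [/\ chord_start q s t, 0 < q.1.2 ^+ 2 + q.2 ^+ 2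
    & quadrant_crossing (corner s0 t0) (corner (s0 + ds) (t0 + dt)) =
        in_quadrant (affine p s t) (affine r s t)].
Proof.
move=> ya0 yb0; have yab : 0 < ya - yb by lra.
have sgn : (0 <= ya) != (0 <= yb) by rewrite ya0 leNgt yb0.
have [s [t [sq nsq q0 l0 E]]] := side_zero sgn; exists s, t; split=> //.
- split=> // s' t' sq' q1; rewrite -subr_ge0 -(pmulr_rge0 _ yab).
  exact: side_along sq' q0 q1 l0 (lt0r_neq0 yab).
- exact: side_gradient (lt0r_neq0 yab).
Qed.

Lemma side_end : ya < 0 -> 0 <= yb ->
  exists s t, [/\ chord_end q s t, 0 < q.1.2 ^+ 2 + q.2 ^+ 2
    & quadrant_crossing (corner s0 t0) (corner (s0 + ds) (t0 + dt)) =
        in_quadrant (affine p s t) (affine r s t)].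
Proof.
move=> ya0 yb0; have yab : ya - yb < 0 by lra.
have sgn : (0 <= ya) != (0 <= yb) by rewrite yb0 leNgt ya0.
have [s [t [sq nsq q0 l0 E]]] := side_zero sgn; exists s, t; split=> //.
- split=> // s' t' sq' q1; rewrite -subr_le0 -(nmulr_rge0 _ yab).
  exact: side_along sq' q0 q1 l0 (ltr0_neq0 yab).
- exact: side_gradient (ltr0_neq0 yab).
Qed.

End Side.

(** The chord maps to a segment in the plane of the values of [p] and [r]. It leaves or enters the
    quadrant through p = 0, r > 0, counted by [local_degree p q r], or through r = 0, p > 0, counted
    by [local_degree q r p]. *)
Lemma chord_quadrants p q r s1 t1 s2 t2 :
  0 < q.1.2 ^+ 2 + q.2 ^+ 2 -> transversal p q r -> transversal q r p ->
  chord_start q s1 t1 -> chord_end q s2 t2 ->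
  (in_quadrant (affine p s1 t1) (affine r s1 t1))%:Z -
  (in_quadrant (affine p s2 t2) (affine r s2 t2))%:Z =
  local_degree p q r - local_degree q r p.
Proof.
move=> N0 tp tr cs ce; have tr' := transversalC tr.
(* Exchanging two forms reverses the Jacobian; this lets [chord_degree] treat both degrees on the
   same chord of [q]. *)
have Er : local_degree q r p = - local_degree r q p.
  rewrite /local_degree; case: asboolP => hz; last first.
    by rewrite asboolF ?oppr0 // => /has_zeroC.
  rewrite asboolT; last exact/has_zeroC.
  have J0 : jacobian q r != 0.
    by case: hz => s [t [sq q0 r0 _]]; case: (tr s t sq q0 r0).
  have -> : jacobian r q = - jacobian q r by rewrite /jacobian; ring.
  by rewrite oppr_lt0; move: J0; case: ltgtP.
rewrite Er (chord_degree N0 tp cs ce) (chord_degree N0 tr' cs ce).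
have [a0 b0] := chord_ends_neq0 tp cs ce.
have [c0 d0] := chord_ends_neq0 tr' cs ce.
have Wp := chord_det_neq0 tp cs ce; have Wr := chord_det_neq0 tr' cs ce.
move: (affine p s1 t1) (affine p s2 t2) (affine r s1 t1) (affine r s2 t2)
  a0 b0 c0 d0 Wp Wr => a b c d a0 b0 c0 d0.
have -> : c * b - d * a = - (a * d - b * c) by ring.
rewrite oppr_eq0 oppr_gt0 oppr_lt0 => Wp Wr.
rewrite /in_quadrant; move: a0 b0 c0 d0.
case: (ltgtP a 0) => // ha _; case: (ltgtP b 0) => // hb _;
  case: (ltgtP c 0) => // hc _; case: (ltgtP d 0) => // hd _ /=;
  case: (ltgtP (a * d - b * c) 0) => //= W; exfalso; by [nra |
  move: (Wp) (Wr); rewrite W eqxx => /implyP; nra].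
Qed.

(** At an interior zero, [q] is a combination of its corner values with positive weights. So all
    corner values vanish, and with them the Jacobian. *)
Lemma no_zero_nonneg p q r : transversal p q r ->
  0 <= affine q 0 0 -> 0 <= affine q 1 0 -> 0 <= affine q 0 1 ->
  0 <= affine q 1 1 -> ~ has_zero p q r.
Proof.
move=> tp y00 y10 y01 y11 [s [t [sq p0 q0 _]]].
have [/andP [/andP [s0 s1] /andP [t0 t1]] /eqP J0 _] := tp s t sq p0 q0.
have := q0.
have -> : affine q s t = (1 - s) * (1 - t) * affine q 0 0 +
    s * (1 - t) * affine q 1 0 + (1 - s) * t * affine q 0 1 +
    s * t * affine q 1 1 by rewrite /affine; ring.
have w00 : 0 < (1 - s) * (1 - t) by nra.
have w10 : 0 < s * (1 - t) by nra.
have w01 : 0 < (1 - s) * t by nra.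
have w11 : 0 < s * t by nra.
move: (mulr_ge0 (ltW w00) y00) (mulr_ge0 (ltW w10) y10)
  (mulr_ge0 (ltW w01) y01) => p00 p10 p01.
move: (mulr_ge0 (ltW w11) y11) => p11 sum0.
have cancel w y : 0 < w -> w * y = 0 -> y = 0.
  by move=> w0 /eqP; rewrite mulf_eq0 (gt_eqF w0) /= => /eqP.
have {}y00 : affine q 0 0 = 0 by apply: cancel w00 _; lra.
have {}y10 : affine q 1 0 = 0 by apply: cancel w10 _; lra.
have {}y01 : affine q 0 1 = 0 by apply: cancel w01 _; lra.
apply: J0; rewrite /jacobian.
have -> : q.1.2 = affine q 1 0 - affine q 0 0 by rewrite /affine; ring.
have -> : q.2 = affine q 0 1 - affine q 0 0 by rewrite /affine; ring.
by rewrite y00 y10 y01; ring.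
Qed.

Lemma no_zero_neg p q r :
  affine q 0 0 < 0 -> affine q 1 0 < 0 -> affine q 0 1 < 0 ->
  affine q 1 1 < 0 -> ~ has_zero p q r.
Proof.
rewrite /has_zero /affine => y00 y10 y01 y11.
move=> [s [t [/andP [/andP [s0 s1] /andP [t0 t1]] _ q0 _]]].
case: (leP 0 q.1.2) => ?; case: (leP 0 q.2) => ?; nra.
Qed.

(** If [q] has one sign at the corners, there is neither flux nor zero. Otherwise one side carries
    the start of the chord and another its end, and [chord_quadrants] applies. *)
Lemma boundary_fluxE p q r : transversal p q r -> transversal q r p ->
  boundary_flux p q r = local_degree p q r - local_degree q r p.
Proof.
move=> tp tr.
have fin := chord_quadrants _ tp tr.
have none : ~ has_zero p q r -> ~ has_zero r q p ->
    0 = local_degree p q r - local_degree q r p.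
  by move=> np nr; rewrite /local_degree !asboolF // => /has_zeroC.
rewrite /boundary_flux /flux.
(* The four sides are run through counterclockwise, so that each has the square on its left. *)
have bot k : 0 <= k <= 1 -> in_square (0 + k * 1) (0 + k * 0) &&
    ~~ in_open_square (0 + k * 1) (0 + k * 0).
  by rewrite /in_square /in_open_square; lra.
have rig k : 0 <= k <= 1 -> in_square (1 + k * 0) (0 + k * 1) &&
    ~~ in_open_square (1 + k * 0) (0 + k * 1).
  by rewrite /in_square /in_open_square; lra.
have top k : 0 <= k <= 1 -> in_square (1 + k * -1) (1 + k * 0) &&
    ~~ in_open_square (1 + k * -1) (1 + k * 0).
  by rewrite /in_square /in_open_square; lra.
have lef k : 0 <= k <= 1 -> in_square (0 + k * 0) (1 + k * -1) &&
    ~~ in_open_square (0 + k * 0) (1 + k * -1).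
  by rewrite /in_square /in_open_square; lra.
have bot' s t : in_square s t -> 0 <= 1 * (t - 0) - 0 * (s - 0) :> R.
  by rewrite /in_square; lra.
have rig' s t : in_square s t -> 0 <= 0 * (t - 0) - 1 * (s - 1) :> R.
  by rewrite /in_square; lra.
have top' s t : in_square s t -> 0 <= -1 * (t - 1) - 0 * (s - 1) :> R.
  by rewrite /in_square; lra.
have lef' s t : in_square s t -> 0 <= 0 * (t - 1) - -1 * (s - 0) :> R.
  by rewrite /in_square; lra.
have := side_start p r bot bot'; have := side_end p r bot bot'.
have := side_start p r rig rig'; have := side_end p r rig rig'.
have := side_start p r top top'; have := side_end p r top top'.
have := side_start p r lef lef'; have := side_end p r lef lef'.
rewrite !subrr !addr0 !add0r.
move=> /(_ q) le /(_ q) ls /(_ q) te /(_ q) ts /(_ q) re /(_ q) rs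
  /(_ q) be /(_ q) bs.
have yE : affine q 0 0 + affine q 1 1 = affine q 1 0 + affine q 0 1.
  by rewrite /affine; ring.
rewrite /=.
case: (leP 0 (affine q 0 0)) => y00; case: (leP 0 (affine q 1 0)) => y10;
  case: (leP 0 (affine q 1 1)) => y11; case: (leP 0 (affine q 0 1)) => y01;
  try by [exfalso; clear - y00 y10 y11 y01 yE; lra
    | rewrite !addr0; apply: none; apply: no_zero_nonneg => //;
      exact: transversalC
    | rewrite !addr0; apply: none; exact: no_zero_neg];
  (have [s1 [t1 [cs N0 ->]]] : exists s t, [/\ chord_start q s t, _ & _] :=
     ltac:(first [exact: bs y00 y10 | exact: rs y10 y11 | exact: ts y11 y01
                 | exact: ls y01 y00]));
  (have [s2 [t2 [ce _ ->]]] : exists s t, [/\ chord_end q s t, _ & _] :=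
     ltac:(first [exact: be y00 y10 | exact: re y10 y11 | exact: te y11 y01
                 | exact: le y01 y00]));
  by rewrite -(fin _ _ _ _ N0 cs ce); ring.
Qed.

End Square.

(** * Determinants, projections and bases in three-space *)

Section Vectors.
Variable R : realType.
Implicit Types (u v w e f : 'rV[R]_3) (k : R).

Lemma sum3 (V : zmodType) (F : 'I_3 -> V) :
  \sum_i F i = F 0 + F 1 + F 2%:R.
Proof.
rewrite !big_ord_recl big_ord0 addr0 addrA.
by congr (_ + F _ + F _); apply: val_inj.
Qed.

Lemma row3P v w :
  v 0 0 = w 0 0 -> v 0 1 = w 0 1 -> v 0 2%:R = w 0 2%:R -> v = w.
Proof.
move=> E0 E1 E2; apply/rowP => -[[|[|[|//]]] i_lt].
- by rewrite (_ : Ordinal _ = 0) //; apply: val_inj.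
- by rewrite (_ : Ordinal _ = 1) //; apply: val_inj.
- by rewrite (_ : Ordinal _ = 2%:R) //; apply: val_inj.
Qed.

Lemma dotE v w :
  dot v w = v 0 0 * w 0 0 + v 0 1 * w 0 1 + v 0 2%:R * w 0 2%:R.
Proof. by rewrite /dot mxE sum3 !mxE. Qed.

Lemma det3E u v w :
  det3 u v w =
  u 0 0 * (v 0 1 * w 0 2%:R - v 0 2%:R * w 0 1) -
  u 0 1 * (v 0 0 * w 0 2%:R - v 0 2%:R * w 0 0) +
  u 0 2%:R * (v 0 0 * w 0 1 - v 0 1 * w 0 0).
Proof.
(* Reading entries by natural numbers makes the differently built ordinals of the cofactor expansion
   compute to the same index. *)
have [g E] : exists g, forall (x : 'rV[R]_3) i, x 0 i = g x (val i).
  exists (fun (x : 'rV[R]_3) (l : nat) => x 0 (inord l)) => x i.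
  by rewrite inord_val.
rewrite /det3 (expand_det_row _ 0) sum3 /cofactor !(expand_det_row _ ord0).
rewrite !big_ord_recl !big_ord0 /cofactor !det_mx11 !mxE !(tnth_nth 0) !E /=.
by rewrite /bump /=; ring.
Qed.

Lemma dot_gt0 u : u != 0 -> 0 < dot u u.
Proof.
move=> u0; rewrite dotE -!expr2 lt0r !addr_ge0 ?sqr_ge0 // andbT.
apply: contraNneq u0 => /eqP.
rewrite !paddr_eq0 ?addr_ge0 ?sqr_ge0 // !sqrf_eq0.
move=> /andP [/andP [/eqP e0 /eqP e1] /eqP e2].
by apply/eqP/row3P; rewrite mxE.
Qed.

Lemma projB u v w : Defs.proj u (v - w) = Defs.proj u v - Defs.proj u w.
Proof.
by apply: row3P; rewrite !(mxE, dotE); ring.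
Qed.

(** Cramer's rule. *)
Lemma det3_basis b1 b2 b3 v :
  det3 b1 b2 b3 *: v =
  det3 b2 b3 v *: b1 + det3 b3 b1 v *: b2 + det3 b1 b2 v *: b3.
Proof. by apply: row3P; rewrite !(mxE, det3E); ring. Qed.

(** This turns the Jacobian of two coordinate forms into the determinant that decides the sign of a
    crossing. *)
Lemma det3_minor b1 b2 b3 e f :
  det3 b3 b1 e * det3 b1 b2 f - det3 b3 b1 f * det3 b1 b2 e =
  det3 b1 b2 b3 * det3 e f b1.
Proof. by rewrite !det3E; ring. Qed.

Lemma det3D b c v w : det3 b c (v + w) = det3 b c v + det3 b c w.
Proof. by rewrite !det3E !mxE; ring. Qed.

Lemma det3Z b c k v : det3 b c (k *: v) = k * det3 b c v.
Proof. by rewrite !det3E !mxE; ring. Qed.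

Lemma det3N b c v : det3 b c (- v) = - det3 b c v.
Proof. by rewrite -scaleN1r det3Z mulN1r. Qed.

Lemma dotB v1 v2 w : dot (v1 - v2) w = dot v1 w - dot v2 w.
Proof. by rewrite !dotE !mxE; ring. Qed.

Lemma dotZ k v w : dot (k *: v) w = k * dot v w.
Proof. by rewrite !dotE !mxE; ring. Qed.

Lemma projD u v w : Defs.proj u (v + w) = Defs.proj u v + Defs.proj u w.
Proof. by apply: row3P; rewrite !(mxE, dotE); ring. Qed.

Lemma proj_scale u k v : Defs.proj u (k *: v) = k *: Defs.proj u v.
Proof. by apply: row3P; rewrite !(mxE, dotE); ring. Qed.

Lemma proj_self u : u != 0 -> Defs.proj u u = 0.
Proof.
move=> u0; rewrite /Defs.proj divff ?scale1r ?subrr //.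
exact/lt0r_neq0/dot_gt0.
Qed.

Lemma proj_eqP u v w : u != 0 ->
  Defs.proj u v = Defs.proj u w <-> exists k, v - w = k *: u.
Proof.
move=> u0; split=> [E|[k E]].
  exists (dot (v - w) u / dot u u); apply/eqP; rewrite -subr_eq0.
  by rewrite -[_ - _ *: _]/(Defs.proj u (v - w)) projB E subrr.
by apply/eqP; rewrite -subr_eq0 -projB E proj_scale proj_self // scaler0.
Qed.

Lemma proj_independent u e f k l m : u != 0 ->
  row_free (col_mx (Defs.proj u e) (Defs.proj u f)) ->
  k *: e + l *: f = m *: u -> k = 0 /\ l = 0.
Proof.
move=> u0 /row_free_inj inj E.
have /eqP : row_mx k%:M l%:M = 0 :> 'rV[R]_(1 + 1).
  apply: inj; rewrite mul0mx mul_row_col !mul_scalar_mx.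
  by rewrite -!proj_scale -projD E proj_scale proj_self // scaler0.
rewrite row_mx_eq0 => /andP [/eqP /matrixP /(_ 0 0) k0 /eqP /matrixP /(_ 0 0)].
by move: k0; rewrite !mxE eqxx !mulr1n.
Qed.

Section Basis.
Variables b1 b2 b3 : 'rV[R]_3.
Hypothesis basis : 0 < det3 b1 b2 b3.

Lemma basis_neq0 : b1 != 0.
Proof.
apply: contraTneq basis => ->; rewrite -leNgt.
by rewrite det3E !mxE !mul0r subrr addr0.
Qed.

Lemma collinearP v :
  det3 b3 b1 v = 0 -> det3 b1 b2 v = 0 ->
  v = (det3 b2 b3 v / det3 b1 b2 b3) *: b1.
Proof.
move=> x0 y0; have := det3_basis b1 b2 b3 v.
rewrite x0 y0 !scale0r !addr0 mulrC -scalerA => <-.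
by rewrite scalerA mulVf ?scale1r // lt0r_neq0.
Qed.

Lemma collinear_forms k :
  [/\ det3 b3 b1 (k *: b1) = 0, det3 b1 b2 (k *: b1) = 0
    & det3 b2 b3 (k *: b1) = k * det3 b1 b2 b3].
Proof. by rewrite !det3Z !det3E; split; ring. Qed.

Lemma proj_independent_det3 e f :
  row_free (col_mx (Defs.proj b1 e) (Defs.proj b1 f)) -> det3 e f b1 != 0.
Proof.
move=> rf; apply/eqP => D0; have u0 := basis_neq0.
have := det3_minor b1 b2 b3 e f; rewrite D0 mulr0 => /eqP.
rewrite subr_eq0 => /eqP minor0.
have dep k l : det3 b3 b1 (k *: e + l *: f) = 0 ->
    det3 b1 b2 (k *: e + l *: f) = 0 -> k = 0 /\ l = 0.
  by move=> /collinearP /[apply] /(proj_independent u0 rf).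
(* Weighting [e] and [f] by each other's coordinates kills both coordinates of the combination, by
   [minor0]. Independence then makes the weights vanish, and finally [f] itself contradicts
   independence. *)
have [x0 _] : det3 b3 b1 f = 0 /\ - det3 b3 b1 e = 0.
  by apply: dep; rewrite !det3D !det3Z ?minor0; ring: minor0.
have [y0 _] : det3 b1 b2 f = 0 /\ - det3 b1 b2 e = 0.
  by apply: dep; rewrite !det3D !det3Z ?minor0; ring: minor0.
have [_ /eqP] : (0 : R) = 0 /\ (1 : R) = 0.
  by apply: dep; rewrite !det3D !det3Z ?x0 ?y0; ring.
by rewrite oner_eq0.
Qed.

End Basis.

End Vectors.

(** * Signed crossings as local degrees of pairs of edges *)

Section Knot.
Variables (R : realType) (n : nat) (P : 'I_n -> 'rV[R]_3).
Implicit Types (i j : 'I_n) (s t : R) (u : 'rV[R]_3).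
Local Notation point := (Defs.point P).
Local Notation edge := (edge P).

(** The end [s = 1] is renamed as the start of the next edge. The last clause undoes this at
    transverse points, where parameters are positive. *)
Lemma closed_paramP i s : 0 <= s <= 1 ->
  exists x, [/\ params x, point x = point (i, s), x.1 \in [:: i; ordS i]
    & 0 < x.2 -> x = (i, s)].
Proof.
move=> /andP [s0]; rewrite le_eqVlt => /predU1P [->|s1].
  exists (ordS i, 0); rewrite /params /= lexx ltr01 !inE eqxx orbT ltxx.
  by split=> //; rewrite /Defs.point /Defs.edge /= scale0r scale1r addr0 subrKC.
by exists (i, s); rewrite /params /= s0 s1 !inE eqxx.
Qed.

Definition nonadjacent i j := [&& i != j, ordS i != j & i != ordS j].

Lemma nonadjacent_neq i j i' j' : nonadjacent i j ->
  i' \in [:: i; ordS i] -> j' \in [:: j; ordS j] -> i' != j'.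
Proof.
case/and3P=> ij Sij iSj; rewrite !inE.
move=> /orP [] /eqP -> /orP [] /eqP -> //.
by rewrite (inj_eq (@ordS_inj n)).
Qed.

(** By Cramer's rule, [face_form b1 b2] is, up to a factor, the coordinate on [b3] of the difference
    of a point of edge [i] and a point of edge [j]. *)
Definition face_form u v i j : R * R * R :=
  (det3 u v (P i - P j), det3 u v (edge i), - det3 u v (edge j)).

Lemma affine_face u v i j s t :
  affine (face_form u v i j) s t = det3 u v (point (i, s) - point (j, t)).
Proof.
rewrite /affine /face_form /Defs.point /= !(det3D, det3N, det3Z); ring.
Qed.

(** The parameters 0 are placeholders, since the sign depends only on the edges. In general position
    at most one crossing has [i] over [j]. *)
Definition pair_degree u i j : int :=
  if `[< exists s t, crossings u P ((i, s), (j, t)) >]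
  then crossing_sign u P ((i, 0), (j, 0)) else 0.

Section Direction.
Variables b1 b2 b3 : 'rV[R]_3.
Hypotheses (basis : 0 < det3 b1 b2 b3) (gp : general_position b1 P).

Lemma jacobian_face i j :
  jacobian (face_form b3 b1 i j) (face_form b1 b2 i j) =
  - (det3 b1 b2 b3 * det3 (edge i) (edge j) b1).
Proof. by rewrite -det3_minor /jacobian /face_form /=; ring. Qed.

(** A common zero of the first two forms is a double point, so general position puts it inside both
    edges and makes the Jacobian nonzero; the third form is nonzero because the knot is simple. *)
Lemma face_transversal i j : polygonal_knot P -> nonadjacent i j ->
  transversal (face_form b3 b1 i j) (face_form b1 b2 i j)
    (face_form b2 b3 i j).
Proof.
case=> _ inj nadj s t /andP [s01 t01]; rewrite !affine_face => x0 y0.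
have E := collinearP basis x0 y0.
have [x [px xE xi xs]] := closed_paramP i s01.
have [y [py yE yj yt]] := closed_paramP j t01.
have nxy : x <> y.
  by move=> xy; have := nonadjacent_neq nadj xi yj; rewrite xy eqxx.
case: gp => u0 _ tr _.
have dbl : double_point b1 P x y.
  split=> //; apply/(proj_eqP _ _ u0); rewrite xE yE.
  by exists (det3 b2 b3 (point (i, s) - point (j, t)) / det3 b1 b2 b3).
have [x2 y2 rf] := tr _ _ dbl.
have {}xs := xs x2; have {}yt := yt y2; subst x y.
split.
- move: px py x2 y2; rewrite /in_open_square /params /=.
  by move=> /andP [_ ->] /andP [_ ->] -> ->.
- rewrite jacobian_face oppr_eq0 mulf_neq0 ?(lt0r_neq0 basis) //.
  exact: (proj_independent_det3 basis rf).
- apply/eqP => z0; apply: nxy; apply: inj; rewrite ?inE //.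
  by apply/eqP; rewrite -subr_eq0 E z0 mul0r scale0r.
Qed.

Lemma local_degree_face i j : polygonal_knot P -> nonadjacent i j ->
  local_degree (face_form b3 b1 i j) (face_form b1 b2 i j)
    (face_form b2 b3 i j) = pair_degree b1 i j.
Proof.
move=> knot nadj; have tr := face_transversal knot nadj.
have u0 := basis_neq0 basis.
rewrite /local_degree jacobian_face oppr_lt0 (pmulr_rgt0 _ basis).
rewrite /pair_degree /crossing_sign /=; congr (if _ then _ else _).
apply/asbool_equiv_eq; split=> [[s [t [sq x0 y0 z0]]]|[s [t]]].
- exists s, t.
  have [/andP [/andP [s0 s1] /andP [t0 t1]] _ _] := tr s t sq x0 y0.
  move: x0 y0 z0; rewrite !affine_face => x0 y0 z0.
  have E := collinearP basis x0 y0; split=> /=; last first.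
    by rewrite -subr_gt0 -dotB E dotZ mulr_gt0 ?dot_gt0 // divr_gt0.
  split; rewrite /params /= ?s1 ?t1 ?ltW //.
    by case=> ij _; move: nadj; rewrite /nonadjacent ij eqxx.
  apply/(proj_eqP _ _ u0).
  by exists (det3 b2 b3 (point (i, s) - point (j, t)) / det3 b1 b2 b3).
- case=> -[/= /andP [s0 s1] /andP [t0 t1] _ /(proj_eqP _ _ u0) [k E]].
  rewrite -subr_gt0 -dotB E dotZ (pmulr_lgt0 _ (dot_gt0 u0)) => k0.
  have [x0 y0 z0] := collinear_forms b1 b2 b3 k.
  exists s, t; rewrite !affine_face E x0 y0 z0 mulr_gt0 //; split=> //.
  by rewrite /in_square s0 t0 !ltW.
Qed.

(** The difference of points on adjacent edges combines the two edge vectors, so independence of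
    their projections would force one parameter to be 1, which [params] excludes. *)
Lemma pair_degree_adjacent i j : ~~ nonadjacent i j -> pair_degree b1 i j = 0.
Proof.
have u0 := basis_neq0 basis; case: gp => _ _ tr _.
rewrite /pair_degree => adj; rewrite asboolF // => -[s [t [dbl _]]].
have [_ _ /= rf] := tr _ _ dbl.
have indep k l m := @proj_independent _ _ _ _ k l m u0 rf.
case: dbl => /= /andP [/= s0 s1] /andP [/= t0 t1] _ /(proj_eqP _ _ u0) [k E].
move: adj; rewrite /nonadjacent !negb_and !negbK => /or3P [] /eqP ij.
- have [/eqP] : (1 : R) = 0 /\ (-1 : R) = 0.
    by apply: (indep _ _ 0); rewrite ij scale1r scaleN1r subrr scale0r.
  by rewrite oner_eq0.
- have [/eqP] : s - 1 = 0 /\ - t = 0.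
    apply: (indep _ _ k); rewrite -E /Defs.point /= -ij /Defs.edge.
    by apply: row3P; rewrite !mxE; ring.
  by rewrite subr_eq0 (lt_eqF s1).
- have [_ /eqP] : s = 0 /\ 1 - t = 0.
    apply: (indep _ _ k); rewrite -E /Defs.point /= ij /Defs.edge.
    by apply: row3P; rewrite !mxE; ring.
  by rewrite subr_eq0 (gt_eqF t1).
Qed.

End Direction.

(** The difference of two crossings on the same edges is a combination of edge vectors parallel to
    [u], hence trivial. *)
Lemma crossings_pair_inj u : general_position u P ->
  set_inj (crossings u P) (fun c => (c.1.1, c.2.1)).
Proof.
case=> u0 _ tr _ [[i s] [j t]] [[i' s'] [j' t']]; rewrite !inE.
case=> dbl _ [dbl' _] /= [E1 E2]; move: E1 E2 dbl' => <- <- dbl'.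
have [_ _ rf] := tr _ _ dbl.
case: dbl dbl' => _ _ _ /(proj_eqP _ _ u0) [k E].
case=> _ _ _ /(proj_eqP _ _ u0) [k' E'].
have [/eqP s0 /eqP t0] : s - s' = 0 /\ t' - t = 0.
  apply: (proj_independent (m := k - k') u0 rf); rewrite [RHS]scalerBl -E -E'.
  by rewrite /Defs.point /=; apply: row3P; rewrite !mxE; ring.
by move: s0 t0; rewrite !subr_eq0 => /eqP -> /eqP ->.
Qed.

Lemma writhe_pairs u : general_position u P ->
  writhe u P = \sum_i \sum_j pair_degree u i j.
Proof.
move=> gp; rewrite pair_bigA /=.
pose sgn (p : 'I_n * 'I_n) := crossing_sign u P ((p.1, 0), (p.2, 0)).
rewrite /writhe -[LHS](fsbig_image _ _ sgn (crossings_pair_inj gp)).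
rewrite (eq_fsbigr (fun p => pair_degree u p.1 p.2)); last first.
  move=> p /set_mem [[[i s] [j t]] cr <-].
  by rewrite /pair_degree /= asboolT //; exists s, t.
apply: fsbig_fwiden; first by move=> p _ /=; rewrite mem_index_enum.
  exact: index_enum_uniq.
move=> [i j] [_ /= nc]; rewrite /pair_degree asboolF // => -[s [t cr]].
by apply: nc; exists ((i, s), (j, t)).
Qed.

Lemma writhe_le_crossing_number u : general_position u P ->
  (`|writhe u P| <= (crossing_number_of_projection u P)%:Z).
Proof.
case=> _ _ _ fin; rewrite /writhe fsbig_finite //=.
apply: le_trans (ler_norm_sum _ _ _) _.
rewrite (eq_bigr (fun=> 1)) => [|c _]; last first.
  by rewrite /crossing_sign; case: ifP.
by rewrite big_const_seq count_predT iter_addr addr0 natz.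
Qed.

(** The projection is the same; a negative factor reverses the view, and [swap] exchanges the
    strands. *)
Lemma crossing_number_scale u k : general_position u P -> k != 0 ->
  crossing_number_of_projection (k *: u) P = crossing_number_of_projection u P.
Proof.
case=> u0 _ _ fin k0.
have projE v : Defs.proj (k *: u) v = Defs.proj u v.
  have d0 := lt0r_neq0 (dot_gt0 u0).
  have dotr a b : dot a (k *: b) = k * dot a b.
    by rewrite !dotE !mxE; ring.
  rewrite /Defs.proj scalerA dotZ !dotr; congr (_ - _ *: _).
  by field; rewrite d0 k0.
have dotZr v : dot v (k *: u) = k * dot v u by rewrite !dotE !mxE; ring.
have dblE x y : double_point (k *: u) P x y <-> double_point u P x y.
  by rewrite /double_point !projE.
pose swap (c : ('I_n * R) * ('I_n * R)) := (c.2, c.1).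
have swapK : involutive swap by case.
rewrite /crossing_number_of_projection.
have [k_lt0|k_gt0|/eqP] := ltgtP k 0; last by rewrite (negPf k0).
- have -> : crossings (k *: u) P = (swap @` crossings u P)%classic.
    apply/seteqP; split=> [[x y] [/= /dblE dbl]|_ [[x y] [/= dbl lt] <-]].
      rewrite !dotZr ltr_nM2l // => lt; exists (y, x) => //; split=> //=.
      by case: dbl => px py nxy E; split=> // yx; apply: nxy.
    split; rewrite /swap /=; last by rewrite !dotZr ltr_nM2l.
    apply/dblE; case: dbl => px py nxy E; split=> // yx; exact: nxy.
  rewrite fset_set_image // card_imfset //=; exact: inv_inj.
- congr (#|` fset_set _|)%fset; apply/seteqP.
  split=> -[x y] [/= /dblE dbl lt]; split=> //=; move: lt;
    by rewrite !dotZr ltr_pM2l.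
Qed.

(** * Cancellation of fluxes and comparison of two writhes *)

Section Comparison.
Variables u u' w : 'rV[R]_3.

Let coords v := (det3 w u v, det3 u u' v, det3 u' w v).
Let hflux i j := flux (coords (P i - P j)) (coords (P (ordS i) - P j)).
Let vflux i j := flux (coords (P i - P j)) (coords (P i - P (ordS j))).
Let face_flux i j := boundary_flux (face_form w u i j) (face_form u u' i j)
  (face_form u' w i j).

Lemma face_fluxE i j :
  face_flux i j = hflux i j + vflux (ordS i) j - hflux i (ordS j) - vflux i j.
Proof.
have p0 l : point (l, 0) = P l by rewrite /Defs.point scale0r addr0.
have p1 l : point (l, 1) = P (ordS l).
  by rewrite /Defs.point scale1r /Defs.edge subrKC.
rewrite /face_flux /boundary_flux /= !affine_face !p0 !p1 -/(coords _).
by congr (_ + _ + _ + _); exact: fluxC.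
Qed.

(** Cyclic indexing glues the squares into a torus, where each side is traversed once in each
    orientation. *)
Lemma sum_face_flux : \sum_i \sum_j face_flux i j = 0.
Proof.
have shift (F : 'I_n -> int) : \sum_i F (ordS i) = \sum_i F i.
  by rewrite [RHS](reindex_inj (@ordS_inj n)).
have -> : \sum_i \sum_j face_flux i j =
    \sum_i (\sum_j vflux (ordS i) j - \sum_j vflux i j).
  apply: eq_bigr => i _; under eq_bigr do rewrite face_fluxE.
  by rewrite !big_split /= !sumrN (shift (hflux i)); ring.
by rewrite sumrB (shift (fun i => \sum_j vflux i j)) subrr.
Qed.

Lemma writhe_diff_le : polygonal_knot P -> general_position u P ->
  general_position u' P -> 0 < det3 u u' w ->
  `|writhe u P - writhe u' P| <= (3 * n)%:Z.
Proof.
move=> knot gp gp' basis.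
(* Cyclic permutation of the basis lets [local_degree_face] also identify the second degree, for the
   direction [u']. *)
have basis' : 0 < det3 u' w u.
  by rewrite (_ : det3 u' w u = det3 u u' w) // !det3E; ring.
have deg i j : nonadjacent i j ->
    face_flux i j = pair_degree u i j - pair_degree u' i j.
  move=> nadj; rewrite /face_flux boundary_fluxE.
  - by rewrite (local_degree_face basis) // (local_degree_face basis').
  - exact: face_transversal.
  - exact: face_transversal.
have -> : writhe u P - writhe u' P =
    - \sum_i \sum_j (if nonadjacent i j then 0 else face_flux i j).
  rewrite !writhe_pairs // -sumrB; apply/eqP; rewrite -addr_eq0 -big_split /=.
  rewrite -[X in _ == X]sum_face_flux; apply/eqP/eq_bigr => i _.
  rewrite -sumrB -big_split; apply: eq_bigr => j _ /=.
  case: ifPn => [/deg ->|adj]; first by rewrite addr0.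
  rewrite (pair_degree_adjacent basis) // (pair_degree_adjacent basis') //.
  by rewrite subrr add0r.
rewrite normrN; apply: le_trans (ler_norm_sum _ _ _) _.
have -> : (3 * n)%:Z = \sum_(i < n) 3 by rewrite sumr_const card_ord; lia.
apply: ler_sum => i _; apply: le_trans (ler_norm_sum _ _ _) _.
(* The factor 3 is the length of this list; repetitions, possible for small [n], only lower the
   count. *)
pose adj := [:: i; ordS i; ord_pred i].
apply: (@le_trans _ _ (\sum_(j in adj) 1)).
  rewrite [leRHS]big_mkcond /=; apply: ler_sum => j _.
  case: ifPn => nadj; first by case: ifP; rewrite normr0.
  rewrite ifT; first exact: boundary_flux_le1.
  move: nadj; rewrite !negb_and !negbK !inE.
  by move=> /or3P [] /eqP ->; rewrite ?eqxx ?orbT // ordSK eqxx !orbT.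
by rewrite sumr_const !natz lez_nat; exact: (card_size adj).
Qed.

End Comparison.

End Knot.

(** * Parallel directions and the final inequality *)

Lemma positive_basis_or_parallel (R : realType) (u u' : 'rV[R]_3) : u != 0 ->
  (exists w, 0 < det3 u u' w) \/ exists k, u' = k *: u.
Proof.
move=> u0; have d0 := dot_gt0 u0.
(* These are the entries of the cross product of [u] and [u']; the determinant with it is its
   squared length. *)
pose m0 := u 0 1 * u' 0 2%:R - u 0 2%:R * u' 0 1.
pose m1 := u 0 2%:R * u' 0 0 - u 0 0 * u' 0 2%:R.
pose m2 := u 0 0 * u' 0 1 - u 0 1 * u' 0 0.
pose w : 'rV[R]_3 := \row_l nth 0 [:: m0; m1; m2] l.
have wE : det3 u u' w = m0 ^+ 2 + m1 ^+ 2 + m2 ^+ 2.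
  by rewrite det3E !mxE /= /m0 /m1 /m2; ring.
have [wgt0|] := ltP 0 (det3 u u' w); first by left; exists w.
rewrite wE => wle0; right; exists (dot u u' / dot u u).
have /eqP : m0 ^+ 2 + m1 ^+ 2 + m2 ^+ 2 = 0.
  by apply/eqP; rewrite eq_le wle0 !addr_ge0 ?sqr_ge0.
rewrite !paddr_eq0 ?addr_ge0 ?sqr_ge0 // !sqrf_eq0.
move=> /andP [/andP [/eqP e0 /eqP e1] /eqP e2].
apply: (scalerI (lt0r_neq0 d0)); rewrite scalerA mulrCA.
rewrite divff ?lt0r_neq0 // mulr1.
apply: row3P; rewrite !mxE !dotE; apply/eqP; rewrite -subr_eq0; apply/eqP.
- transitivity (u 0 2%:R * m1 - u 0 1 * m2); first by rewrite /m1 /m2; ring.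
  by rewrite e1 e2 !mulr0 subrr.
- transitivity (u 0 0 * m2 - u 0 2%:R * m0); first by rewrite /m0 /m2; ring.
  by rewrite e0 e2 !mulr0 subrr.
- transitivity (u 0 1 * m0 - u 0 0 * m1); first by rewrite /m1 /m0; ring.
  by rewrite e0 e1 !mulr0 subrr.
Qed.

Unset Implicit Arguments.
Set Strict Implicit.

(* u is the direction of the projection K, u' that of K'. *)
Theorem theorem3p3 (R : realType) (n : nat) (P : 'I_n -> 'rV[R]_3)
    (u u' : 'rV[R]_3) :
  polygonal_knot P ->
  general_position u P ->
  general_position u' P ->
  (1 / 16%:R) * ((`|writhe u P|)%:~R - 3%:R * n%:R)
    <= (crossing_number_of_projection u' P)%:R :> R.
Proof.
move=> knot gp gp'; set c := crossing_number_of_projection u' P.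
(* This bound has the constant 1 in place of 1/16; it suffices because [c] is nonnegative. *)
suff : `|writhe u P| <= (3 * n + c)%:Z.
  rewrite -(ler_int R) -[((3 * n + c)%:Z)%:~R]/((3 * n + c)%:R) natrD natrM.
  by have : 0 <= c%:R :> R := ler0n _ _; lra.
have [u0 _ _ _] := gp; have [u'0 _ _ _] := gp'.
have [[w basis]|[k u'E]] := positive_basis_or_parallel u' u0.
  have := writhe_diff_le knot gp gp' basis.
  have := writhe_le_crossing_number gp'; rewrite -/c.
  by move: (writhe u P) (writhe u' P) => a b; lia.
have k0 : k != 0 by apply: contraNneq u'0 => k0; rewrite u'E k0 scale0r.
apply: le_trans (writhe_le_crossing_number gp) _.
by rewrite /c u'E crossing_number_scale // lez_nat leq_addl.
Qed.
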